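(* Let $i\in I^-$ and $n\ge1$, and let $R_n=R(ni)$ be the associated quiver Hecke algebra. Then the one-dimensional module $V$, on which all generators $x_1,\dots,x_n,\tau_1,\dots,\tau_{n-1}$ act by zero, is the unique gr-irreducible $R_n$-module, up to isomorphism and a degree shift.
   Context: $\mathbb K$ is a fixed algebraically closed field. $i\in I^-$ means an index of a Borcherds-Cartan datum with $a_{ii}\in\{0,-2,-4,\dots\}$; $r_i$ is a positive integer and $i\cdot i=r_ia_{ii}\le0$. $R_n=R(ni)$ is the graded $\mathbb K$-algebra with generators $x_1,\dots,x_n$ of degree $2r_i$ and $\tau_1,\dots,\tau_{n-1}$ of degree $-i\cdot i$, subject to: $x_kx_t=x_tx_k$ for all $k,t$; $\tau_k^2=0$; $\tau_k\tau_{k+1}\tau_k=\tau_{k+1}\tau_k\tau_{k+1}$; $\tau_k\tau_t=\tau_t\tau_k$ if $|k-t|>1$; $x_k\tau_k=\tau_kx_{k+1}$; $\tau_kx_k=x_{k+1}\tau_k$; $\tau_kx_t=x_t\tau_k$ if $t\ne k,k+1$. ''Gr-irreducible'' means a nonzero $\mathbb Z$-graded module with no proper nonzero graded submodule. In the paper $V$ arises as the submodule $\mathrm{Span}\{\tau_{\omega_0}\otimes v\}$ of $R_n\otimes_{P_n}L$, where $P_n=\mathbb K[x_1,\dots,x_n]$, $L=\mathbb Kv$ is the trivial one-dimensional $P_n$-module, and $\omega_0$ is the longest element of $S_n$. *)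

(* Defs.v *)
From HB Require Import structures.
From mathcomp Require Import all_boot all_order all_algebra finmap.
From mathcomp Require Import ring_quotient.
From mathcomp.multinomials Require Import monalg.
From mathcomp Require Import boolp.

Set Implicit Arguments.
Unset Strict Implicit.
Unset Printing Implicit Defensive.

Import GRing.Theory.
Local Open Scope fset_scope.
Local Open Scope ring_scope.
Local Open Scope quotient_scope.

Record borcherds_cartan := BorcherdsCartan {
  bc_index :> Type;
  bc_a : bc_index -> bc_index -> int;
  bc_r : bc_index -> nat;
  bc_diag : forall i, exists k : nat, bc_a i i = 2%:Z - (2 * k)%N%:Z;
  bc_offdiag : forall i j, i <> j -> bc_a i j <= 0;
  bc_r_gt0 : forall i, (0 < bc_r i)%N;
  bc_sym : forall i j, (bc_r i)%:Z * bc_a i j = (bc_r j)%:Z * bc_a j i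
}.

Definition bc_form (D : borcherds_cartan) (i j : D) : int :=
  (bc_r i)%:Z * bc_a i j.

(* Membership in I^-; with bc_diag, the diagonal entry is 0, -2, -4, etc. *)
Definition imaginary (D : borcherds_cartan) (i : D) : Prop := bc_a i i <= 0.

(* inl k stands for the generator x_(k+1) and inr k for tau_(k+1). *)
Definition letter (n : nat) : Type := ('I_n + 'I_n.-1)%type.
HB.instance Definition _ n := Finite.on (letter n).

Section Presentation.
Variables (K : closedFieldType) (n : nat).

Local Notation freealg := {malg K[{fmonom (letter n)}]}.

Definition fgen (l : letter n) : freealg := << fmu l >>.
Local Notation X k := (fgen (inl k)).
Local Notation T k := (fgen (inr k)).

(* tau_k relates x_k and x_(k+1): the side conditions on the ordinals a and b
   below say that they are the positions k and k+1. *)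
Inductive hecke_rel : freealg -> Prop :=
| rel_xx (k t : 'I_n) : hecke_rel (X k * X t - X t * X k)
| rel_tau2 (k : 'I_n.-1) : hecke_rel (T k * T k)
| rel_braid (k l : 'I_n.-1) : l = k.+1 :> nat ->
    hecke_rel (T k * T l * T k - T l * T k * T l)
| rel_tautau (k t : 'I_n.-1) : (k.+1 < t)%N || (t.+1 < k)%N ->
    hecke_rel (T k * T t - T t * T k)
| rel_xtau (k : 'I_n.-1) (a b : 'I_n) : a = k :> nat -> b = k.+1 :> nat ->
    hecke_rel (X a * T k - T k * X b)
| rel_taux (k : 'I_n.-1) (a b : 'I_n) : a = k :> nat -> b = k.+1 :> nat ->
    hecke_rel (T k * X a - X b * T k)
| rel_taux_far (k : 'I_n.-1) (t : 'I_n) : t <> k :> nat -> t <> k.+1 :> nat ->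
    hecke_rel (T k * X t - X t * T k).

(* The two-sided ideal generated by the relations. *)
Inductive hecke_ideal : freealg -> Prop :=
| ideal_rel f : hecke_rel f -> hecke_ideal f
| ideal0 : hecke_ideal 0
| idealD f g : hecke_ideal f -> hecke_ideal g -> hecke_ideal (f + g)
| idealM a f b : hecke_ideal f -> hecke_ideal (a * f * b).

Definition hecke_idealb : pred freealg := fun f => `[< hecke_ideal f >].

Lemma hecke_idealP f : reflect (hecke_ideal f) (f \in hecke_idealb).
Proof. exact: asboolP. Qed.

Lemma hecke_idealMl a f : f \in hecke_idealb -> a * f \in hecke_idealb.
Proof.
by move=> /hecke_idealP If; apply/hecke_idealP; rewrite -[_ * _]mulr1; apply: idealM.
Qed.

Lemma hecke_idealMr a f : f \in hecke_idealb -> f * a \in hecke_idealb.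
Proof.
by move=> /hecke_idealP If; apply/hecke_idealP; rewrite -[f]mul1r; apply: idealM.
Qed.

Fact hecke_ideal_zmod : zmod_closed hecke_idealb.
Proof.
split=> [|f g If Ig]; first by apply/hecke_idealP; apply: ideal0.
apply/hecke_idealP; apply: idealD; first exact/hecke_idealP.
by apply/hecke_idealP; rewrite -mulN1r; apply: hecke_idealMl.
Qed.
HB.instance Definition _ :=
  GRing.isZmodClosed.Build freealg hecke_idealb hecke_ideal_zmod.

Lemma hecke_ideal_const f : f \in hecke_idealb -> f@_mone = 0.
Proof.
have M (f1 f2 : freealg) : (f1 * f2)@_mone = f1@_mone * f2@_mone :> K.
  exact: (mcoeff1g_is_multiplicative {fmonom (letter n)} K).1.
have E l : (fgen l)@_mone = 0 by rewrite mcoeffU fm1_eq1.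
have Z (f1 f2 : freealg) : f1@_mone = 0 -> (f1 * f2)@_mone = 0.
  by rewrite M => ->; rewrite mul0r.
have B (f1 f2 : freealg) : f1@_mone = 0 -> f2@_mone = 0 -> (f1 - f2)@_mone = 0.
  by rewrite mcoeffB => -> ->; rewrite subr0.
move=> /hecke_idealP; elim=> {f}.
- move=> f [k t|k|k l _|k t _|k a b _ _|k a b _ _|k t _ _].
  + by apply: (B); apply: (Z); apply: (E).
  + by apply: (Z); apply: (E).
  + by apply: (B); apply: (Z); apply: (Z); apply: (E).
  + by apply: (B); apply: (Z); apply: (E).
  + by apply: (B); apply: (Z); apply: (E).
  + by apply: (B); apply: (Z); apply: (E).
  + by apply: (B); apply: (Z); apply: (E).
- by rewrite mcoeff0.
- by move=> f g _ f0 _ g0; rewrite mcoeffD f0 g0 addr0.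
- by move=> a f b _ f0; rewrite !M f0 mulr0 mul0r.
Qed.

Lemma free_scaleAr (c : K) (f g : freealg) : c *: (f * g) = f * (c *: g).
Proof.
apply/malgP => w; apply: (etrans (mcoeffZ c (f * g) w)).
apply: (etrans (congr1 ( *%R c) (mcoeffMl f g w))); rewrite mulr_sumr.
apply/esym/(etrans (mcoeffMlw w (fsubset_refl _) (msuppZ_le c g)))/eq_bigr.
move=> u _; rewrite mulr_sumr; apply: eq_bigr => v _.
by rewrite mcoeffZ mulrnAr mulrCA.
Qed.

(* The algebra R(ni) for i imaginary: its underlying ungraded algebra does not
   depend on i, which enters only through the degrees in hecke_gr below. *)
Definition hecke : Type := 
  Quotient.quot (GRing.ZmodClosed.clone freealg hecke_idealb _).
HB.instance Definition _ := Choice.on hecke.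
HB.instance Definition _ := GRing.Zmodule.on hecke.

Definition hpi (f : freealg) : hecke := \pi_hecke f.

Lemma hpi_eq f g : (hpi f == hpi g) = (f - g \in hecke_idealb).
Proof. by rewrite /hpi Quotient.idealrBE. Qed.

Lemma hpiK (r : hecke) : hpi (repr r) = r.
Proof. exact: reprK. Qed.

Lemma hpiB : {morph hpi : f g / f - g}.
Proof. by move=> f g; rewrite /hpi !piE. Qed.

Lemma hpiD : {morph hpi : f g / f + g}.
Proof. by move=> f g; rewrite /hpi !piE. Qed.

Definition hecke_one : hecke := hpi 1.
Definition hecke_mul (r s : hecke) : hecke := hpi (repr r * repr s).
Definition hecke_scale (c : K) (r : hecke) : hecke := hpi (c *: repr r).

Lemma hpi_mul f g : hecke_mul (hpi f) (hpi g) = hpi (f * g).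
Proof.
apply/eqP; rewrite hpi_eq.
set f' := repr (hpi f); set g' := repr (hpi g).
have -> : f' * g' - f * g = (f' - f) * g' + f * (g' - g).
  by rewrite mulrBl mulrBr addrA subrK.
by apply: rpredD; [apply: hecke_idealMr | apply: hecke_idealMl];
  rewrite -hpi_eq hpiK.
Qed.

Lemma hpi_scale c f : hecke_scale c (hpi f) = hpi (c *: f).
Proof.
apply/eqP; rewrite hpi_eq -scalerBr -mul_malgC; apply: hecke_idealMl.
by rewrite -hpi_eq hpiK.
Qed.

Fact hecke_mulA : associative hecke_mul.
Proof.
by move=> r s t; rewrite -[r]hpiK -[s]hpiK -[t]hpiK !hpi_mul mulrA.
Qed.
Fact hecke_mul1r : left_id hecke_one hecke_mul.
Proof. by move=> r; rewrite -[r]hpiK hpi_mul mul1r. Qed.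
Fact hecke_mulr1 : right_id hecke_one hecke_mul.
Proof. by move=> r; rewrite -[r]hpiK hpi_mul mulr1. Qed.
Fact hecke_mulDl : left_distributive hecke_mul +%R.
Proof.
by move=> r s t; rewrite -[r]hpiK -[s]hpiK -[t]hpiK -hpiD !hpi_mul mulrDl hpiD.
Qed.
Fact hecke_mulDr : right_distributive hecke_mul +%R.
Proof.
by move=> r s t; rewrite -[r]hpiK -[s]hpiK -[t]hpiK -hpiD !hpi_mul mulrDr hpiD.
Qed.
Fact hecke_oner_neq0 : hecke_one != 0.
Proof.
have -> : 0 = hpi 0 by apply/esym; rewrite -(subrr 0) hpiB subrr.
rewrite hpi_eq subr0; apply/negP => /hecke_ideal_const/eqP.
by rewrite mcoeff1 eqxx oner_eq0.
Qed.
HB.instance Definition _ := GRing.Zmodule_isNzRing.Build hecke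
  hecke_mulA hecke_mul1r hecke_mulr1 hecke_mulDl hecke_mulDr hecke_oner_neq0.

Fact hecke_scaleA a b r : hecke_scale a (hecke_scale b r) = hecke_scale (a * b) r.
Proof. by rewrite -[r]hpiK !hpi_scale scalerA. Qed.
Fact hecke_scale1 : left_id 1 hecke_scale.
Proof. by move=> r; rewrite -[r]hpiK hpi_scale scale1r. Qed.
Fact hecke_scaleDr : right_distributive hecke_scale +%R.
Proof.
by move=> c r s; rewrite -[r]hpiK -[s]hpiK -hpiD !hpi_scale scalerDr hpiD.
Qed.
Fact hecke_scaleDl r : {morph hecke_scale^~ r : a b / a + b}.
Proof. by move=> a b; rewrite -[r]hpiK !hpi_scale scalerDl hpiD. Qed.
HB.instance Definition _ := GRing.Zmodule_isLmodule.Build K hecke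
  hecke_scaleA hecke_scale1 hecke_scaleDr hecke_scaleDl.

Fact hecke_scaleAl (c : K) (r s : hecke) : c *: (r * s) = (c *: r) * s.
Proof.
rewrite -[r]hpiK -[s]hpiK; change (hecke_scale c (hecke_mul (hpi (repr r)) (hpi (repr s))) =
  hecke_mul (hecke_scale c (hpi (repr r))) (hpi (repr s))).
by rewrite hpi_mul !hpi_scale hpi_mul scalerAl.
Qed.
HB.instance Definition _ := GRing.Lmodule_isLalgebra.Build K hecke hecke_scaleAl.

Fact hecke_scaleAr (c : K) (r s : hecke) : c *: (r * s) = r * (c *: s).
Proof.
rewrite -[r]hpiK -[s]hpiK; change (hecke_scale c (hecke_mul (hpi (repr r)) (hpi (repr s))) =
  hecke_mul (hpi (repr r)) (hecke_scale c (hpi (repr s)))).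
by rewrite hpi_mul !hpi_scale hpi_mul free_scaleAr.
Qed.
HB.instance Definition _ := GRing.Lalgebra_isAlgebra.Build K hecke hecke_scaleAr.

Definition hx (k : 'I_n) : hecke := hpi (X k).
Definition htau (k : 'I_n.-1) : hecke := hpi (T k).

Lemma hpiM : {morph hpi : f g / f * g}.
Proof. by move=> f g; rewrite -hpi_mul. Qed.

Lemma hpiZ c : {morph hpi : f / c *: f}.
Proof. by move=> f; rewrite -hpi_scale. Qed.

Lemma hecke_rel0 f : hecke_rel f -> hpi f = 0.
Proof.
move=> rf; apply/eqP; rewrite -(subrr (hpi 0)) -hpiB hpi_eq subrr subr0.
by apply/hecke_idealP/ideal_rel.
Qed.

(* The augmentation: every generator is sent to 0. *)
Definition haug (r : hecke) : K := (repr r : freealg)@_mone.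

Lemma haug_pi f : haug (hpi f) = f@_mone.
Proof.
apply/eqP; rewrite -subr_eq0 -mcoeffB; apply/eqP/hecke_ideal_const.
by rewrite -hpi_eq hpiK.
Qed.

End Presentation.

Arguments hx K n k : clear implicits.
Arguments htau K n k : clear implicits.

Section AugmentationTheory.
Variables (K : closedFieldType) (n : nat).
Implicit Types r s : hecke K n.

Lemma haugD : {morph @haug K n : r s / r + s}.
Proof.
by move=> r s; rewrite -[r]hpiK -[s]hpiK -hpiD !haug_pi mcoeffD.
Qed.

Lemma haugM : {morph @haug K n : r s / r * s}.
Proof.
move=> r s; rewrite -[r]hpiK -[s]hpiK -hpiM !haug_pi.
exact: (mcoeff1g_is_multiplicative {fmonom (letter n)} K).1.
Qed.

Lemma haug1 : haug (1 : hecke K n) = 1.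
Proof. by rewrite [LHS]haug_pi mcoeff1 eqxx. Qed.

Lemma haugZ c r : haug (c *: r) = c * haug r.
Proof. by rewrite -[r]hpiK -hpiZ !haug_pi mcoeffZ. Qed.

Lemma haug_x k : haug (hx K n k) = 0.
Proof. by rewrite haug_pi mcoeffU fm1_eq1. Qed.

Lemma haug_tau k : haug (htau K n k) = 0.
Proof. by rewrite haug_pi mcoeffU fm1_eq1. Qed.

End AugmentationTheory.

(* M is the direct sum of the subgroups C d, for d in Z. *)
Definition is_grading (M : zmodType) (C : int -> M -> Prop) : Prop :=
  [/\ forall d, C d 0,
      forall d m m', C d m -> C d m' -> C d (m - m'),
      forall m, exists (s : seq int) (f : int -> M),
        [/\ uniq s, forall d, C d (f d) & m = \sum_(d <- s) f d]
    & forall (s : seq int) (f : int -> M), uniq s -> (forall d, C d (f d)) ->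
        \sum_(d <- s) f d = 0 -> forall d, d \in s -> f d = 0].

Section Grading.
Variables (K : closedFieldType) (D : borcherds_cartan) (i : D) (n : nat).
Local Notation freealg := {malg K[{fmonom (letter n)}]}.

Definition letter_deg (l : letter n) : int :=
  if l is inl _ then (2 * bc_r i)%N%:Z else - bc_form i i.

Definition word_deg (w : {fmonom (letter n)}) : int :=
  \sum_(l <- (w : seq (letter n))) letter_deg l.

Definition free_hom (d : int) (f : freealg) : Prop :=
  forall w, w \in msupp f -> word_deg w = d.

Definition hecke_gr (d : int) (r : hecke K n) : Prop :=
  exists2 f : freealg, free_hom d f & r = hpi f.

Lemma word_degM w1 w2 : word_deg (mmul w1 w2) = word_deg w1 + word_deg w2.
Proof. by rewrite /word_deg fmM big_cat. Qed.

Lemma word_degU l : word_deg (fmu l) = letter_deg l.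
Proof. by rewrite /word_deg fmU big_seq1. Qed.

Lemma word_deg1 : word_deg mone = 0.
Proof. by rewrite /word_deg fm1 big_nil. Qed.

Definition free_proj (d : int) (f : freealg) : freealg :=
  \sum_(w <- msupp f | word_deg w == d) << f@_w *g w >>.

Lemma free_projE d f w :
  (free_proj d f)@_w = if word_deg w == d then f@_w else 0.
Proof.
rewrite /free_proj raddf_sum /= big_mkcond /=.
transitivity (\sum_(v <- msupp f)
    if word_deg w == d then << f@_v *g v >>@_w else 0).
  apply: eq_bigr => v _; rewrite mcoeffU.
  by case: (eqVneq v w) => [->|_] //; rewrite mulr0n !if_same.
case: ifP => _; last by rewrite big1.
by rewrite [in RHS](monalgE f) raddf_sum.
Qed.

Lemma free_projB d f g : free_proj d (f - g) = free_proj d f - free_proj d g.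
Proof.
apply/malgP => w; apply: (etrans (free_projE d (f - g) w)).
apply/esym/(etrans (mcoeffB w _ _)).
apply: (etrans (f_equal2 (fun a b => a - b) (free_projE d f w) (free_projE d g w))).
by case: ifP => _; [exact/esym/mcoeffB | rewrite subr0].
Qed.

Lemma free_projD d f g : free_proj d (f + g) = free_proj d f + free_proj d g.
Proof.
apply/malgP => w; apply: (etrans (free_projE d (f + g) w)).
apply/esym/(etrans (mcoeffD w _ _)).
apply: (etrans (f_equal2 (fun a b => a + b) (free_projE d f w) (free_projE d g w))).
by case: ifP => _; [exact/esym/mcoeffD | rewrite addr0].
Qed.

Lemma free_proj0 d : free_proj d 0 = 0.
Proof. by apply/malgP => w; rewrite free_projE !mcoeff0 if_same. Qed.

Lemma free_proj_sum d (I : Type) (s : seq I) (F : I -> freealg) :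
  free_proj d (\sum_(j <- s) F j) = \sum_(j <- s) free_proj d (F j).
Proof. exact: (big_morph _ (free_projD d) (free_proj0 d)). Qed.

Lemma free_projU d c w :
  free_proj d << c *g w >> = if word_deg w == d then << c *g w >> else 0.
Proof.
apply/malgP => v; rewrite free_projE mcoeffU.
case: (eqVneq w v) => [<-|wv].
  by case: ifP => _; rewrite ?mcoeff0 // mcoeffU eqxx.
by rewrite mulr0n if_same; case: ifP; rewrite ?mcoeff0 // mcoeffU (negbTE wv).
Qed.

Lemma free_proj_hom d e f : free_hom e f ->
  free_proj d f = if e == d then f else 0.
Proof.
move=> fe; apply/malgP => w; rewrite free_projE.
case: (msuppP f w) => [/fe ->|wf]; first by case: ifP; rewrite ?mcoeff0.
by rewrite if_same; case: ifP; rewrite ?mcoeff0 // mcoeff_outdom.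
Qed.

Lemma free_projP d f : free_hom d (free_proj d f).
Proof. move=> w; by rewrite -mcoeff_neq0 free_projE; case: ifP => [/eqP|_ /eqP]. Qed.

Lemma free_projMUU d c1 w1 f c2 w2 :
  free_proj d (<< c1 *g w1 >> * f * << c2 *g w2 >>) =
  << c1 *g w1 >> * free_proj (d - word_deg w1 - word_deg w2) f * << c2 *g w2 >>.
Proof.
rewrite [in LHS](monalgE f) [in RHS](monalgE f) mulr_sumr mulr_suml.
rewrite !free_proj_sum mulr_sumr mulr_suml; apply: eq_bigr => w _.
rewrite free_projU [_ * << f@_w *g w >>]fgmulUU.
rewrite [<< _ *g _ >> * << _ *g _ >>]fgmulUU free_projU !word_degM.
have -> : (word_deg w1 + word_deg w + word_deg w2 == d) =
          (word_deg w == d - word_deg w1 - word_deg w2).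
  by rewrite [RHS]eq_sym !subr_eq [RHS]eq_sym -addrA addrC.
case: ifP => _; last by rewrite mulr0 mul0r.
by rewrite [_ * << f@_w *g w >>]fgmulUU [RHS]fgmulUU.
Qed.

Lemma free_hom0 d : free_hom d 0.
Proof. by move=> w; rewrite msupp0 in_fset0. Qed.

Lemma free_homB d f g : free_hom d f -> free_hom d g -> free_hom d (f - g).
Proof.
move=> fd gd w /(fsubsetP (msuppB_le _ _)).
by rewrite in_fsetU => /orP[/fd | /gd].
Qed.

Lemma free_homM c d e f g : free_hom d f -> free_hom e g -> d + e = c ->
  free_hom c (f * g).
Proof.
move=> fd ge <- w /msuppM_le [w1 [w2 [/fd w1d /ge w2e ->]]].
by rewrite word_degM w1d w2e.
Qed.

Lemma free_homU l : free_hom (letter_deg l) (fgen K l).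
Proof.
move=> w /(fsubsetP msuppU_le); rewrite in_fset1 => /eqP ->.
exact: word_degU.
Qed.

Lemma hecke_rel_hom f : hecke_rel f -> exists d, free_hom d f.
Proof.
pose x := (2 * bc_r i)%N%:Z; pose t := - bc_form i i.
have X k : free_hom x (fgen K (inl k)) by apply: free_homU.
have T k : free_hom t (fgen K (inr k)) by apply: free_homU.
case=> [k l|k|k l _|k l _|k a b _ _|k a b _ _|k l _ _].
- by exists (x + x); apply: free_homB; apply: (free_homM (X _) (X _)).
- by exists (t + t); apply: (free_homM (T _) (T _)).
- exists (t + t + t); apply: free_homB;
  by apply: (free_homM (free_homM (T _) (T _) erefl) (T _)).
- by exists (t + t); apply: free_homB; apply: (free_homM (T _) (T _)).
- exists (x + t); apply: free_homB; first exact: (free_homM (X _) (T _)).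
  by apply: (free_homM (T _) (X _)); rewrite addrC.
- exists (x + t); apply: free_homB; last exact: (free_homM (X _) (T _)).
  by apply: (free_homM (T _) (X _)); rewrite addrC.
- exists (x + t); apply: free_homB; last exact: (free_homM (X _) (T _)).
  by apply: (free_homM (T _) (X _)); rewrite addrC.
Qed.

Lemma hecke_ideal_sum (I : eqType) (s : seq I) (F : I -> freealg) :
  (forall j, j \in s -> hecke_ideal (F j)) -> hecke_ideal (\sum_(j <- s) F j).
Proof.
move=> IF; rewrite big_seq; apply: big_ind => //; first exact: ideal0.
exact: idealD.
Qed.

Lemma hecke_ideal_proj f : hecke_ideal f -> forall d, hecke_ideal (free_proj d f).
Proof.
elim=> {f} [f rf||f g _ If _ Ig|a f b _ If] d.
- have [e fe] := hecke_rel_hom rf; rewrite (free_proj_hom _ fe).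
  by case: ifP => _; [apply: ideal_rel | apply: ideal0].
- by rewrite free_proj0; apply: ideal0.
- by rewrite free_projD; apply: idealD.
have -> : a * f * b = \sum_(u <- msupp a) \sum_(v <- msupp b)
    << a@_u *g u >> * f * << b@_v *g v >>.
  apply: (etrans (f_equal2 (fun a' b' => a' * f * b') (monalgE a) (monalgE b))).
  rewrite (mulr_suml _ _ _ f) mulr_suml.
  by apply: eq_bigr => u _; rewrite mulr_sumr.
rewrite free_proj_sum; apply: hecke_ideal_sum => u _.
rewrite free_proj_sum; apply: hecke_ideal_sum => v _.
by rewrite free_projMUU; apply: idealM.
Qed.

Lemma hpi0 : hpi (0 : freealg) = 0.
Proof. by rewrite -(subrr 0) hpiB subrr. Qed.

Lemma hpi_eq0 (f : freealg) : hpi f = 0 <-> hecke_ideal f.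
Proof.
rewrite -hpi0; split => [/eqP|If]; last apply/eqP; rewrite hpi_eq subr0.
  by move/hecke_idealP.
exact/hecke_idealP.
Qed.

Lemma hpi_sum (I : Type) (s : seq I) (F : I -> freealg) :
  hpi (\sum_(j <- s) F j) = \sum_(j <- s) hpi (F j).
Proof. exact: (big_morph _ (@hpiD K n) hpi0). Qed.

(* The relations are homogeneous, so that the degrees of the generators do
   define a grading of the quotient. *)
Lemma hecke_is_grading : is_grading hecke_gr.
Proof.
split.
- by move=> d; exists 0; [apply: free_hom0 | rewrite hpi0].
- move=> d _ _ [f fd ->] [g gd ->].
  by exists (f - g); [apply: free_homB | rewrite hpiB].
- move=> r; exists (undup [seq word_deg w | w <- msupp (repr r)]).
  exists (fun d => hpi (free_proj d (repr r))); split.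
  + exact: undup_uniq.
  + by move=> d; exists (free_proj d (repr r)); first exact: free_projP.
  rewrite -hpi_sum -[LHS]hpiK; congr hpi; move: (repr r) => f.
  apply/malgP => w; apply/esym/(etrans (raddf_sum (mcoeff w) _ _ _)).
  apply: (etrans (eq_bigr _ (fun d _ => free_projE d f w))).
  case: (msuppP f w) => [wf|_]; last by rewrite big1 // => d _; rewrite if_same.
  rewrite (bigD1_seq (word_deg w)) ?undup_uniq ?mem_undup ?(map_f _ wf) //=.
  by rewrite eqxx big1 ?addr0 // => d /negbTE; rewrite eq_sym => ->.
move=> s f us fgr sum0 d ds.
have /choice[g gP] e : exists g : freealg, free_hom e g /\ f e = hpi g.
  by have [g ge fe] := fgr e; exists g.
have [_ ->] := gP d; apply/hpi_eq0.
have {sum0}/hpi_eq0/hecke_ideal_proj/(_ d) : hpi (\sum_(e <- s) g e) = 0.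
  by rewrite hpi_sum -[RHS]sum0; apply: eq_bigr => e _; have [_ ->] := gP e.
suff -> : free_proj d (\sum_(e <- s) g e) = g d by [].
rewrite free_proj_sum (bigD1_seq d) //= big1 ?addr0 => [|e /negbTE ed].
  by have [gd _] := gP d; rewrite (free_proj_hom _ gd) eqxx.
by have [ge _] := gP e; rewrite (free_proj_hom _ ge) ed.
Qed.

Lemma hecke_gr1 : hecke_gr 0 1.
Proof.
exists 1 => // w /(fsubsetP msuppU_le); rewrite in_fset1 => /eqP ->.
exact: word_deg1.
Qed.

Lemma hecke_grM d e r s : hecke_gr d r -> hecke_gr e s -> hecke_gr (d + e) (r * s).
Proof.
move=> [f fd ->] [g ge ->]; exists (f * g); last by rewrite hpiM.
exact: (free_homM fd ge).
Qed.

Lemma hecke_gr_x k : hecke_gr (2 * bc_r i)%N%:Z (hx K n k).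
Proof. by exists (fgen K (inl k)) => //; apply: free_homU. Qed.

Lemma hecke_gr_tau k : hecke_gr (- bc_form i i) (htau K n k).
Proof. by exists (fgen K (inr k)) => //; apply: free_homU. Qed.

End Grading.

Arguments hecke_gr K {D} i n d r.

(* Graded left modules over a ring A with grading C. *)
Record gr_module (A : pzRingType) (C : int -> A -> Prop) := GrModule {
  gr_carrier :> lmodType A;
  gr_comp : int -> gr_carrier -> Prop;
  gr_comp_grading : is_grading gr_comp;
  gr_comp_scale : forall d e a m,
    C d a -> gr_comp e m -> gr_comp (d + e) (a *: m)
}.

Section GradedModules.
Variables (A : pzRingType) (C : int -> A -> Prop).

Definition submodule (M : lmodType A) (N : M -> Prop) : Prop :=
  N 0 /\ forall (a : A) (u v : M), N u -> N v -> N (a *: u + v).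

(* A submodule N is graded when it is the sum of its intersections with the
   homogeneous components of M. *)
Definition gr_submodule (M : gr_module C) (N : M -> Prop) : Prop :=
  submodule N /\
  forall m, N m -> exists (s : seq int) (f : int -> M),
    (forall d, gr_comp d (f d) /\ N (f d)) /\ m = \sum_(d <- s) f d.

Definition gr_irreducible (M : gr_module C) : Prop :=
  (exists m : M, m <> 0) /\
  forall N : M -> Prop, gr_submodule N ->
    (forall m, N m -> m = 0) \/ (forall m, N m).

(* M is isomorphic to N with its degrees shifted by d. *)
Definition gr_iso_shift (M N : gr_module C) (d : int) : Prop :=
  exists f : {linear M -> N}, bijective f /\
    forall e (m : M), gr_comp e m <-> gr_comp (e + d) (f m).

End GradedModules.

(* The line K on which every generator acts by zero, that is, on which the
   algebra acts through the augmentation; it is placed in degree 0 below. *)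
Definition triv (K : closedFieldType) (n : nat) : Type := K.

Section TrivialModule.
Variables (K : closedFieldType) (D : borcherds_cartan) (i : D) (n : nat).
Local Notation triv := (triv K n).

HB.instance Definition _ := GRing.Zmodule.on triv.

Definition triv_scale (r : hecke K n) (v : triv) : triv := (haug r * v : K).

Fact triv_scaleA r s v : triv_scale r (triv_scale s v) = triv_scale (r * s) v.
Proof. by rewrite /triv_scale haugM mulrA. Qed.
Fact triv_scale1 : left_id 1 triv_scale.
Proof. by move=> v; rewrite /triv_scale haug1 mul1r. Qed.
Fact triv_scaleDr : right_distributive triv_scale +%R.
Proof. by move=> r u v; rewrite /triv_scale [LHS]mulrDr. Qed.
Fact triv_scaleDl v : {morph triv_scale^~ v : r s / r + s}.
Proof. by move=> r s; rewrite /triv_scale haugD [LHS]mulrDl. Qed.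
HB.instance Definition _ := GRing.Zmodule_isLmodule.Build (hecke K n) triv
  triv_scaleA triv_scale1 triv_scaleDr triv_scaleDl.

Lemma triv_scaleE (r : hecke K n) (v : triv) : r *: v = (haug r * v : K).
Proof. by []. Qed.

Lemma triv_x k (v : triv) : hx K n k *: v = 0.
Proof. by rewrite triv_scaleE haug_x mul0r. Qed.

Lemma triv_tau k (v : triv) : htau K n k *: v = 0.
Proof. by rewrite triv_scaleE haug_tau mul0r. Qed.

Lemma triv_scaleC (c : K) (v : triv) : (c%:A : hecke K n) *: v = (c * v : K).
Proof. by rewrite triv_scaleE haugZ haug1 mulr1. Qed.

Definition triv_comp (d : int) (v : triv) : Prop := d <> 0 -> v = 0.

Lemma triv_grading : is_grading triv_comp.
Proof.
split=> [d _|d u v du dv d0|v|s f us fd] //.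
- by rewrite du // dv // subr0.
- exists [:: 0], (fun d => if d == 0 then v else 0); split=> // [d|].
    by rewrite /triv_comp; case: eqP.
  by rewrite big_seq1 eqxx.
move=> sum0 d ds; have [d0|/eqP d0] := eqVneq d 0; last exact: (fd d d0).
rewrite -sum0 (bigD1_seq d) //= big1 ?addr0 // => e ed; apply: (fd e).
by move=> e0; rewrite e0 d0 eqxx in ed.
Qed.

Lemma triv_comp_scale d e (r : hecke K n) (v : triv) :
  hecke_gr K i n d r -> triv_comp e v -> triv_comp (d + e) (r *: v).
Proof.
move=> [f fd ->] ev de; have [d0|/eqP d0] := eqVneq d 0.
  by rewrite ev ?scaler0 // => e0; apply: de; rewrite d0 e0.
rewrite triv_scaleE haug_pi; case: (msuppP f mone) => [/fd|_]; last first.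
  exact: mul0r.
by rewrite word_deg1 => /esym.
Qed.

Definition triv_module : gr_module (hecke_gr K i n) :=
  GrModule triv_grading triv_comp_scale.

End TrivialModule.

Arguments triv_module K {D} i n.

(* Main.v *)
From HB Require Import structures.
Require Import Defs.
From mathcomp Require Import all_boot all_order all_algebra.
From mathcomp Require Import boolp.
From mathcomp.multinomials Require Import monalg.
From mathcomp Require Import zify.

Set Implicit Arguments.
Unset Strict Implicit.
Unset Printing Implicit Defensive.

Import Order.TTheory GRing.Theory Num.Theory.
Local Open Scope ring_scope.

(** Since [i] is imaginary, [- i.i] is nonnegative, so every generator of the
    algebra [R] has nonnegative degree and [R] lives in degrees [>= 0].  In a
    graded module over such a ring the elements of degree at least [e] form a
    graded submodule, so an irreducible [M] is concentrated in one degree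
    [d] ([gr_irreducible_one_degree]).  Two consequences follow: the [x_k],
    whose degree is positive, kill [M]; and every submodule of [M] is graded,
    so that [M] is irreducible in the ungraded sense too.

    The [tau_k] may have degree [0], so degrees say nothing about them.  They
    satisfy the relations of the nil-Coxeter algebra of the symmetric group,
    whose augmentation ideal is nilpotent; only the following consequence is
    established, directly: every nonzero module over these relations contains
    a nonzero vector [u] killed by all [tau_k] ([nilcoxeter_kernel]).

    Then all the generators kill [u], hence [R] acts on [u] through the
    augmentation ([hecke_acts_by_aug]) and the line [K u] is a nonzero
    submodule.  By irreducibility it is all of [M], and [c |-> c u] identifies
    the trivial module with [M], up to moving degree [d] to degree [0]. *)

(** * Gradings *)

Section Gradings.
Variables (M : zmodType) (C : int -> M -> Prop).
Hypothesis gradC : is_grading C.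

Lemma grading0 d : C d 0.
Proof. by case: gradC. Qed.

Lemma gradingB d m m' : C d m -> C d m' -> C d (m - m').
Proof. by case: gradC => _ CB _ _; apply: CB. Qed.

Lemma gradingN d m : C d m -> C d (- m).
Proof. by rewrite -sub0r; apply: gradingB; apply: grading0. Qed.

Lemma gradingD d m m' : C d m -> C d m' -> C d (m + m').
Proof. by move=> Cm /gradingN Cm'; rewrite -[m']opprK; apply: gradingB. Qed.

Lemma grading_nonzero (m : M) : m <> 0 -> exists d m', C d m' /\ m' <> 0.
Proof.
case: gradC => _ _ /(_ m) [s [f [_ Cf ->]]] _ sum0.
apply: contrapT => no; apply: sum0; apply: big1 => d _.
by apply: contrapT => fd; apply: no; exists d, (f d).
Qed.

(** Collecting the terms of each degree turns an arbitrary finite list of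
    homogeneous elements into a family indexed by degrees. *)
Lemma sum_by_degree (l : seq (int * M)) :
  \sum_(p <- l) p.2 =
  \sum_(d <- undup (map fst l)) \sum_(p <- l | p.1 == d) p.2.
Proof.
under [RHS]eq_bigr do rewrite big_mkcond /=.
rewrite [RHS]exchange_big /= !big_seq; apply: eq_bigr => p pl.
rewrite (bigD1_seq p.1) ?undup_uniq ?mem_undup ?map_f //= eqxx.
by rewrite big1 ?addr0 // => d /negbTE; rewrite eq_sym => ->.
Qed.

Lemma grading_sum (I : eqType) d (l : seq I) (P : pred I) (F : I -> M) :
  (forall p, p \in l -> P p -> C d (F p)) -> C d (\sum_(p <- l | P p) F p).
Proof.
move=> CF; rewrite big_seq_cond.
apply: big_ind => [|m m'|p /andP[]]; [exact: grading0|exact: gradingD|].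
exact: CF.
Qed.

(** Uniqueness of homogeneous components, in the form that does not require the
    terms of the sum to have distinct degrees. *)
Lemma grading_avoid d m (l : seq (int * M)) : C d m ->
  (forall p, p \in l -> C p.1 p.2 /\ p.1 != d) -> m = \sum_(p <- l) p.2 ->
  m = 0.
Proof.
move=> dm lP; rewrite sum_by_degree; set s := undup _ => m_sum.
have ds : d \notin s.
  by rewrite mem_undup; apply/mapP => -[p /lP[_ /eqP pd] /esym].
have [_ _ _ free] := gradC.
(* The family witnessing the relation m - sum = 0, with - m in degree d. *)
pose f e := if e == d then - m else \sum_(p <- l | p.1 == e) p.2.
have fd : f d = - m by rewrite /f eqxx.
apply/eqP; rewrite -oppr_eq0 -fd; apply/eqP.
apply: (free (d :: s)); last exact: mem_head.
- by rewrite /= ds undup_uniq.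
- move=> e; rewrite /f; case: eqP => [->|_]; first exact: gradingN.
  by apply: grading_sum => p /lP[+ _] /eqP <-.
rewrite big_cons fd {1}m_sum addrC; apply/eqP; rewrite subr_eq0; apply/eqP.
rewrite !big_seq; apply: eq_bigr => e es.
by rewrite /f; case: eqP => // ed; rewrite -ed es in ds.
Qed.

Lemma grading_disjoint d e (m : M) : e != d -> C d m -> C e m -> m = 0.
Proof.
move=> ed dm em; apply: (grading_avoid (l := [:: (e, m)]) dm).
  by move=> p /[!inE] /eqP ->.
by rewrite big_seq1.
Qed.

End Gradings.

(** * Irreducible modules over a nonnegatively graded ring *)

Section NonnegativelyGraded.
Variables (A : pzRingType) (C : int -> A -> Prop).
Hypothesis gradC : is_grading C.
Hypothesis C_ge0 : forall d a, C d a -> d < 0 -> a = 0.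
Variable M : gr_module C.

Let gradM := gr_comp_grading M.

(** Being graded asks for a family indexed by degrees; [sum_by_degree] builds it
    from any list of homogeneous elements, with repeated degrees allowed. *)
Lemma gr_submodule_of_hom (N : M -> Prop) :
  submodule N ->
  (forall m, N m -> exists2 l : seq (int * M),
     forall p, p \in l -> gr_comp p.1 p.2 /\ N p.2 & m = \sum_(p <- l) p.2) ->
  gr_submodule N.
Proof.
move=> [N0 NZ] decN; split=> // m /decN [l lP ->].
exists (undup (map fst l)), (fun d => \sum_(p <- l | p.1 == d) p.2).
split; last exact: sum_by_degree.
move=> d; split; first by apply: grading_sum => // p /lP [+ _] /eqP <-.
rewrite big_seq_cond; apply: big_ind => // [u v Nu Nv|p /andP[/lP[]//]].
by rewrite -[u]scale1r; apply: NZ.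
Qed.

(** The truncation of [M] to degrees [>= e], given by lists in which degrees may
    repeat so that a sum of two elements is a mere concatenation. *)
Definition degree_ge (e : int) (m : M) : Prop :=
  exists2 l : seq (int * M),
    forall p, p \in l -> gr_comp p.1 p.2 /\ e <= p.1 & m = \sum_(p <- l) p.2.

Lemma degree_ge_hom e d m : gr_comp d m -> e <= d -> degree_ge e m.
Proof.
by exists [:: (d, m)]; [move=> p /[!inE] /eqP -> | rewrite big_seq1].
Qed.

(** Scalars do not lower degrees: in a product of homogeneous terms, those with
    a coefficient of negative degree vanish. *)
Lemma degree_ge_gr_submodule e : gr_submodule (degree_ge e).
Proof.
apply: gr_submodule_of_hom; last first.
  move=> m [l lP ->]; exists l => // p /lP[pp ep]; split=> //.
  exact: degree_ge_hom pp ep.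
split=> [|a u v [l lP ->] [l' lP' ->]]; first by exists [::]; rewrite ?big_nil.
case: gradC => _ _ /(_ a) [s [f [_ fP ->]]] _.
exists ([seq (d + p.1, f d *: p.2) | d <- [seq d <- s | 0 <= d], p <- l] ++ l').
  move=> r; rewrite mem_cat => /orP[|/lP'//].
  case/allpairsP=> -[d p] /= []; rewrite mem_filter => /andP[d0 _] /lP[pp ep] ->.
  by split; [apply: gr_comp_scale | rewrite -[e]add0r lerD].
rewrite big_cat big_allpairs_dep big_filter /=; congr (_ + _).
rewrite scaler_suml [RHS]big_mkcond; apply: eq_bigr => d _ /=.
case: lerP => [_|d0]; first exact: scaler_sumr.
by rewrite (C_ge0 (fP d) d0) scale0r.
Qed.

(** If [m] is nonzero of degree [d], the truncation to degrees [>= d] is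
    nonzero, hence everything, while the truncation to degrees [>= d + 1] misses
    [m], hence is zero. *)
Lemma gr_irreducible_one_degree :
  gr_irreducible M -> exists d, forall m : M, gr_comp d m.
Proof.
move=> [[m0 /(grading_nonzero gradM)[d [m [dm m_neq0]]]] irr].
exists d => u.
have [/(_ m (degree_ge_hom dm (lexx d)))//|/(_ u)[l lP ->]] :=
  irr _ (degree_ge_gr_submodule d).
have above0 e (v : M) : gr_comp e v -> d < e -> v = 0.
  have [gt0|/(_ m) [k kP m_sum] _ _] := irr _ (degree_ge_gr_submodule (d + 1)).
    by move=> ev de; apply: gt0; apply: degree_ge_hom ev _; rewrite lezD1.
  case: m_neq0; apply: (grading_avoid gradM dm _ m_sum) => p /kP[pp dp].
  by split=> //; apply: contraTneq dp => ->; rewrite gerDl.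
apply: (grading_sum gradM) => p /lP[pp]; rewrite le_eqVlt => /orP[/eqP->//|].
by move=> /(above0 _ _ pp) -> _; apply: grading0.
Qed.

End NonnegativelyGraded.

(** * Vectors annihilated by nilpotent braid generators *)

Section InfinitelyMany.
Variables (A : pzRingType) (M : lmodType A) (T : nat -> A).
Hypothesis T_sq : forall k, T k * T k = 0.
Hypothesis T_braid : forall k, T k * T k.+1 * T k = T k.+1 * T k * T k.+1.
Hypothesis T_comm : forall k t, (k.+1 < t)%N -> T k * T t = T t * T k.

(** Start from [u_(j+1)] killed by [T_0, ..., T_(j-1)], and form
    [u_k := T_k u_(k+1) = T_k T_(k+1) ... T_j u_(j+1)] for decreasing [k], stopping
    just before zero is reached.  The invariant is that among [T_0, ..., T_j]
    only [T_(k-1)] can fail to kill [u_k].  It passes from [u = u_(k+1)] to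
    [T_k u]: [T_k] kills it by nilpotency, generators far from [T_k] commute with
    [T_k], and [T_(k+1)] is handled by the braid relation, which needs to
    remember that [u = T_(k+1) v] with [T_k v = 0].  If [T_(k-1)] kills [u_k] too,
    or if [k = 0], then [u_k] is the desired vector. *)
Lemma nilcoxeter_descent j k (u : M) : u <> 0 ->
  (forall t, (t <= j)%N -> t.+1 <> k -> T t *: u = 0) ->
  ((k <= j)%N -> exists2 v, u = T k *: v & forall s, s.+1 = k -> T s *: v = 0) ->
  exists2 u' : M, u' <> 0 & forall t, (t <= j)%N -> T t *: u' = 0.
Proof.
elim: k u => [|k IHk] u u_neq0 u_ker u_im.
  by exists u => // t tj; apply: u_ker.
have [Tku|Tku] := pselect (T k *: u = 0).
  exists u => // t tj; have [->//|tk] := eqVneq t k.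
  by apply: u_ker => // -[/eqP]; apply/negP.
apply: (IHk (T k *: u)) => //.
  move=> t tj tk; have [->|t_neq_k] := eqVneq t k.
    by rewrite scalerA T_sq scale0r.
  have [tE|t_neq_k1] := eqVneq t k.+1; last first.
    have Tt_u : T t *: u = 0 by apply: u_ker => // -[/eqP]; apply/negP.
    have [kt|tk'] := ltnP k.+1 t.
      by rewrite scalerA -T_comm // -scalerA Tt_u scaler0.
    by rewrite scalerA T_comm -?scalerA ?Tt_u ?scaler0 //; lia.
  subst t; have [v -> vker] := u_im tj.
  by rewrite 2!scalerA -T_braid -scalerA vker // scaler0.
move=> kj; exists u => // s sk; apply: u_ker; lia.
Qed.

Lemma nilcoxeter_kernel_nat j (m : M) : m <> 0 ->
  exists2 u : M, u <> 0 & forall t, (t < j)%N -> T t *: u = 0.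
Proof.
move=> m_neq0; elim: j => [|j [u u_neq0 u_ker]]; first by exists m.
apply: (@nilcoxeter_descent j j.+1 u) => // [t tj tj'|]; last by rewrite ltnn.
by apply: u_ker; lia.
Qed.

End InfinitelyMany.

Section FinitelyMany.
Variables (A : pzRingType) (M : lmodType A) (p : nat) (T : 'I_p -> A).
Hypothesis T_sq : forall k, T k * T k = 0.
Hypothesis T_braid : forall k l : 'I_p, l = k.+1 :> nat ->
  T k * T l * T k = T l * T k * T l.
Hypothesis T_comm : forall k l : 'I_p, (k.+1 < l)%N -> T k * T l = T l * T k.

(** Padding the family by zeros preserves the relations, and reduces the
    statement to a family indexed by all natural numbers. *)
Lemma nilcoxeter_kernel (m : M) : m <> 0 ->
  exists2 u : M, u <> 0 & forall k, T k *: u = 0.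
Proof.
pose S k : A := if insub k is Some k' then T k' else 0.
have SP k : S k = 0 \/ exists2 k' : 'I_p, k' = k :> nat & S k = T k'.
  by rewrite /S; case: insubP => [k' _ <-|_]; [right; exists k'|left].
have S_sq k : S k * S k = 0.
  by have [->|[k' _ ->]] := SP k; rewrite ?mulr0.
have S_braid k : S k * S k.+1 * S k = S k.+1 * S k * S k.+1.
  have [->|[k' kE ->]] := SP k; first by rewrite !(mulr0, mul0r).
  have [->|[l lE ->]] := SP k.+1; first by rewrite !(mulr0, mul0r).
  by apply: T_braid; rewrite lE kE.
have S_comm k t : (k.+1 < t)%N -> S k * S t = S t * S k.
  move=> kt; have [->|[k' kE ->]] := SP k; first by rewrite mulr0 mul0r.
  have [->|[l lE ->]] := SP t; first by rewrite mulr0 mul0r.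
  by apply: T_comm; rewrite lE kE.
move=> /(nilcoxeter_kernel_nat S_sq S_braid S_comm p)[u u_neq0 u_ker].
by exists u => // k; have := u_ker k (ltn_ord k); rewrite /S valK.
Qed.

End FinitelyMany.

(** * Scalar actions and linear bijections *)

Section ScalarAction.
Variables (K : fieldType) (A : algType K) (M : lmodType A).
Implicit Types (b c d : K) (r s : A) (u : M).

Definition acts_by u r c : Prop := r *: u = c%:A *: u.

Lemma acts_by1 u : acts_by u 1 1.
Proof. by rewrite /acts_by [1%:A]scale1r. Qed.

Lemma acts_by0 u r : r *: u = 0 -> acts_by u r 0.
Proof. by rewrite /acts_by [0%:A]scale0r scale0r. Qed.

Lemma acts_byD u r s c d :
  acts_by u r c -> acts_by u s d -> acts_by u (r + s) (c + d).
Proof. by rewrite /acts_by [(c + d)%:A]scalerDl !scalerDl => -> ->. Qed.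

Lemma acts_byE u r c d : acts_by u r c -> r *: (d%:A *: u) = (c * d)%:A *: u.
Proof.
move=> ru; have -> : r *: (d%:A *: u) = d%:A *: (r *: u).
  by rewrite !scalerA -scalerAr mulr1 -scalerAl mul1r.
by rewrite ru scalerA -scalerAl mul1r scalerA mulrC.
Qed.

Lemma acts_byM u r s c d :
  acts_by u r c -> acts_by u s d -> acts_by u (r * s) (c * d).
Proof. by move=> ru su; rewrite /acts_by -scalerA su; apply: acts_byE. Qed.

Lemma acts_byZ u r b c : acts_by u r c -> acts_by u (b *: r) (b * c).
Proof.
by move=> ru; rewrite /acts_by -[b *: r]mulr_algl -[LHS]scalerA ru scalerA
  mulr_algl scalerA.
Qed.

Lemma scale_alg_inj u c d : u <> 0 -> c%:A *: u = d%:A *: u -> c = d.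
Proof.
move=> u_neq0 /eqP; rewrite -subr_eq0 -!scalerBl => /eqP cdu.
apply/eqP; rewrite -subr_eq0; apply: contra_notT u_neq0 => cd_neq0.
by rewrite -[u]scale1r -[1]scale1r -(mulVf cd_neq0) -scalerA -mulr_algl
  -scalerA cdu scaler0.
Qed.

End ScalarAction.

Lemma linear_inverse (A : pzRingType) (U V : lmodType A) (g : {linear U -> V}) :
  injective g -> (forall v, exists u, v = g u) ->
  exists2 f : {linear V -> U}, bijective f & cancel f g.
Proof.
move=> g_inj /choice[h hP].
have gK : cancel g h by move=> u; apply: g_inj; rewrite -hP.
have h_lin : linear h by move=> a u v; apply: g_inj; rewrite linearP -!hP.
pose H := GRing.isLinear.Build A V U *:%R h h_lin.
pose f : {linear V -> U} := HB.pack h H.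
by exists f; [exists g | move=> v; rewrite -hP].
Qed.

(** * The quiver Hecke algebra of an imaginary vertex *)

Section Hecke.
Variables (K : closedFieldType) (n : nat).
Local Notation R := (hecke K n).
Local Notation freealg := {malg K[{fmonom (letter n)}]}.

Lemma hecke_relE (f g : freealg) : hecke_rel (f - g) -> hpi f = hpi g.
Proof. by move/hecke_rel0/eqP; rewrite hpiB subr_eq0 => /eqP. Qed.

Lemma hpiM3 (f g h : freealg) : hpi (f * g * h) = hpi f * hpi g * hpi h.
Proof. by rewrite (hpiM (f * g) h) (hpiM f g). Qed.

Lemma htau_sq k : htau K n k * htau K n k = 0.
Proof. by have := hecke_rel0 (rel_tau2 K k); rewrite hpiM. Qed.

Lemma htau_braid (k l : 'I_n.-1) : l = k.+1 :> nat ->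
  htau K n k * htau K n l * htau K n k = htau K n l * htau K n k * htau K n l.
Proof.
move=> kl; have E := hecke_relE (rel_braid K kl).
exact: etrans (esym (hpiM3 _ _ _)) (etrans E (hpiM3 _ _ _)).
Qed.

Lemma htau_comm (k l : 'I_n.-1) : (k.+1 < l)%N ->
  htau K n k * htau K n l = htau K n l * htau K n k.
Proof.
move=> kl; have kl' : (k.+1 < l)%N || (l.+1 < k)%N by rewrite kl.
have E := hecke_relE (rel_tautau K kl').
by apply: etrans (esym (hpiM _ _)) (etrans E (hpiM _ _)).
Qed.

(** A representative of [r] in the free algebra is a linear combination of
    words, and a word is a product of letters. *)
Lemma hecke_gen_ind (P : R -> Prop) :
  (forall k, P (hx K n k)) -> (forall k, P (htau K n k)) ->
  P 1 -> (forall r s, P r -> P s -> P (r + s)) ->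
  (forall r s, P r -> P s -> P (r * s)) -> (forall c r, P r -> P (c *: r)) ->
  forall r, P r.
Proof.
move=> Px Pt P1 PD PM PZ r; rewrite -[r]hpiK; move: (repr r) => f.
have P0 : P 0 by rewrite -(scale0r 1); apply: PZ.
rewrite (monalgE f) hpi_sum; apply: big_ind => // w _.
have -> : << f@_w *g w >> = f@_w *: << w >>.
  by apply/malgP => v; rewrite mcoeffZ !mcoeffU mulrnAr mulr1.
rewrite hpiZ; apply: PZ; case: w => w; elim: w => [|l w IHw].
  by rewrite -fmoneE; apply: P1.
have -> : FMonom (l :: w) = mmul (fmu l) (FMonom w).
  by rewrite [RHS]fmmulE fmuE.
rewrite -(mulr1 1) -fgmulUU hpiM; apply: PM => //; case: l; [exact: Px|exact: Pt].
Qed.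

Lemma hecke_acts_by_aug (M : lmodType R) (u : M) :
  (forall k, hx K n k *: u = 0) -> (forall k, htau K n k *: u = 0) ->
  forall r : R, acts_by u r (haug r).
Proof.
move=> xu tu; apply: hecke_gen_ind.
- by move=> k; rewrite haug_x; apply/acts_by0/xu.
- by move=> k; rewrite haug_tau; apply/acts_by0/tu.
- by rewrite haug1; apply: acts_by1.
- by move=> r s ru su; rewrite haugD; apply: acts_byD.
- by move=> r s ru su; rewrite haugM; apply: acts_byM.
- by move=> c r ru; rewrite haugZ; apply: acts_byZ.
Qed.

Variables (D : borcherds_cartan) (i : D).
Hypothesis i_imag : imaginary i.

Lemma bc_form_le0 : bc_form i i <= 0.
Proof. by rewrite /bc_form mulr_ge0_le0. Qed.

(** This is where [i.i <= 0] enters. *)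
Lemma hecke_gr_ge0 d (r : R) : hecke_gr K i n d r -> d < 0 -> r = 0.
Proof.
move=> [f fd ->] d0; rewrite -[RHS]hpi0; congr hpi; apply/malgP => w.
rewrite mcoeff0; case: (msuppP f w) => // /fd wd.
move: d0; rewrite -wd ltNge sumr_ge0 // => -[k|k] _ //=.
by rewrite oppr_ge0 bc_form_le0.
Qed.

Lemma triv_irreducible : gr_irreducible (triv_module K i n).
Proof.
split; first by exists (1 : K); apply/eqP/oner_neq0.
move=> N [[N0 NZ] _].
have [N0'|] := pselect (forall m, N m -> m = 0); first by left.
move=> /existsNP[v /not_implyP[Nv /eqP v_neq0]]; right=> w.
have := NZ ((w / v : K)%:A) v 0 Nv N0.
by rewrite addr0 triv_scaleC divfK.
Qed.

End Hecke.

Theorem theorem2p6 (K : closedFieldType) (D : borcherds_cartan) (i : D)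
    (hi : imaginary i) (n : nat) (hn : (1 <= n)%N) :
  gr_irreducible (triv_module K i n) /\
  forall M : gr_module (hecke_gr K i n), gr_irreducible M ->
    exists d : int, gr_iso_shift M (triv_module K i n) d.
Proof.
split=> [|M irrM]; first exact: triv_irreducible.
have gradM := gr_comp_grading M.
have [d Md] := gr_irreducible_one_degree (hecke_is_grading K i n)
  (hecke_gr_ge0 hi) irrM.
(* x_k m lies both in degree d and in degree d + 2 r_i. *)
have x0 k (m : M) : hx K n k *: m = 0.
  apply: (@grading_disjoint _ _ gradM d ((2 * bc_r i)%N%:Z + d)) => //.
    by have := bc_r_gt0 i; lia.
  exact/gr_comp_scale/Md/hecke_gr_x.
case: (irrM) => -[m0 m0_neq0] irr.
have [u u_neq0 tau0] := nilcoxeter_kernel (@htau_sq K n) (@htau_braid K n)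
  (@htau_comm K n) m0_neq0.
have act_u := hecke_acts_by_aug (x0^~ u) tau0.
pose g (c : triv K n) : M := ((c : K)%:A : hecke K n) *: u.
have g_lin : linear g.
  move=> r a b; rewrite /g (acts_byE _ (act_u r)) -scalerDl; congr (_ *: u).
  exact: scalerDl.
have g_inj : injective g by move=> a b; apply: scale_alg_inj.
pose G : {linear triv K n -> M} :=
  HB.pack g (GRing.isLinear.Build (hecke K n) (triv K n) M *:%R g g_lin).
have g_surj m : exists c, m = G c.
  pose N m := exists c, m = G c.
  (* Everything has degree d, so the submodule N is automatically graded. *)
  have N_gr : gr_submodule N.
    split=> [|w Nw].
      split=> [|r v w [a ->] [b ->]]; first by exists 0; rewrite linear0.
      by exists (r *: a + b); rewrite linearP.
    exists [:: d], (fun e => if e == d then w else 0).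
    rewrite big_seq1 eqxx; split=> // e; case: eqP => [->|_]; first by split.
    by split; [apply: grading0 | exists 0; rewrite linear0].
  have [N0|] := irr N N_gr; last exact.
  case: u_neq0; apply: N0; exists (1 : K).
  by rewrite /= /g [1%:A]scale1r scale1r.
have [f f_bij fK] := linear_inverse (g := G) g_inj g_surj.
exists (- d), f; split=> // e m.
split=> [em ed|em].
  have e_neq_d : e != d by apply/eqP => /eqP; rewrite -subr_eq0 => /eqP.
  by rewrite (grading_disjoint gradM e_neq_d (Md m) em) linear0.
have [->//|e_neq_d] := eqVneq e d.
rewrite -[m]fK em ?linear0; first exact: grading0.
by apply/eqP; rewrite subr_eq0.
Qed.
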